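(* Let $n\ge 2$ be an integer and assume that $A$ is $n$-good. Either $\dim_H(U_A)\ge \log(2)/\log(n)$ or $U_A=\{0,2\}$.
   Context: For an integer $n\ge 2$ and a set $A$ of integers with $0,n-1\in A\subset\{0,1,\dots,n-1\}$, $C_A=C_{A,n}=\left\{\sum_{i=1}^\infty a_i n^{-i} : a_i\in A\right\}$, which is the attractor of the iterated function system $\{x\mapsto (x+a)/n : a\in A\}$. The sign $+$ between sets denotes the Minkowski sum. The set $A$ is called $n$-good if $0,n-1\in A\subset\{0,1,\dots,n-1\}$ and $C_A+C_A=[0,2]$. $U_A$ (the set of uniqueness) is the set of $z\in C_A+C_A$ for which there is exactly one ordered pair $(x,y)\in C_A\times C_A$ with $z=x+y$. $\dim_H$ denotes Hausdorff dimension. *)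

(* Defs.v *)
From HB Require Import structures.
From mathcomp Require Import all_boot all_order all_algebra.
From mathcomp Require Import all_classical all_reals all_analysis.

Set Implicit Arguments.
Unset Strict Implicit.
Unset Printing Implicit Defensive.

Import Order.TTheory GRing.Theory Num.Theory.
Import numFieldNormedType.Exports.

Local Open Scope classical_set_scope.
Local Open Scope ring_scope.

Definition minkowski_sum (V : zmodType) (E F : set V) : set V :=
  [set x + y | x in E & y in F].

(* The digit a_i of the usual expansion (i >= 1) is [a i.-1] here. The sums
   are required to converge, so no junk value of [lim] can occur. *)
Definition cantor_sum_set (R : realType) (n : nat) (A : set int) : set R :=
  [set x | exists2 a : nat -> int, (forall i, A (a i)) &
     series (fun i => (a i)%:~R * n%:R ^- i.+1 : R) @ \oo --> x].
Arguments cantor_sum_set : clear implicits.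

Definition n_good (R : realType) (n : nat) (A : set int) : Prop :=
  [/\ A 0, A (n%:Z - 1),
      A `<=` [set a | 0 <= a <= n%:Z - 1] &
      minkowski_sum (cantor_sum_set R n A) (cantor_sum_set R n A)
        = `[0, 2]%classic].

Definition uniqueness_set (R : realType) (n : nat) (A : set int) : set R :=
  let C := cantor_sum_set R n A in
  [set z | minkowski_sum C C z /\
     exists! p : R * R, (C `*` C) p /\ z = p.1 + p.2].
Arguments uniqueness_set : clear implicits.

Section hausdorff.
Context (R : realType).
Local Open Scope ereal_scope.

(* The diameter of the empty set is -oo here. *)
Definition diameter (E : set R) : \bar R :=
  ereal_sup [set `|x - y|%:E | x in E & y in E].

(* |E|^s with |set0|^s = 0, also for s = 0; for nonempty E, 0 ^ 0 = 1, so that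
   the 0-dimensional measure is the counting measure. *)
Definition diameter_pow (s : R) (E : set R) : \bar R :=
  if E == set0 then 0 else diameter E `^ s.

(* Members of a cover may be empty, so finite covers are included. *)
Definition hausdorff_premeasure (s delta : R) (E : set R) : \bar R :=
  ereal_inf [set \sum_(0 <= k <oo) diameter_pow s (U k) | U in
    [set U : nat -> set R | E `<=` \bigcup_k U k /\
                            forall k, diameter (U k) <= delta%:E]].

(* The premeasure is nonincreasing in delta, so the limit as delta -> 0+ is
   the supremum. *)
Definition hausdorff_measure (s : R) (E : set R) : \bar R :=
  ereal_sup [set hausdorff_premeasure s delta E | delta in
    [set delta : R | (0 < delta)%R]].

Definition hausdorff_dim (E : set R) : \bar R :=
  ereal_inf [set s%:E | s in
    [set s : R | (0 <= s)%R /\ hausdorff_measure s E = 0]].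

End hausdorff.

(* Main.v *)
Require Import Defs.
From HB Require Import structures.
From mathcomp Require Import all_boot all_order all_algebra.
From mathcomp Require Import all_classical all_reals all_analysis.
From mathcomp Require Import ring lra zify.

Set Implicit Arguments.
Unset Strict Implicit.
Unset Printing Implicit Defensive.

Import Order.TTheory GRing.Theory Num.Theory.
Import numFieldNormedType.Exports.

Local Open Scope classical_set_scope.
Local Open Scope ring_scope.

(** A point z of U_A must be z = 2 v with v in C = C_A, since swapping the two
summands gives another decomposition.  Let N = n and write N v = a + w with a
a digit and w in C.  Whether 2 v has only the decomposition v + v is decided
digit by digit: the tail w must have the same property, and a must be [rigid]
at w, meaning that b = c = a is the only pair of digits for which the remainder
2 w + 2 a - b - c stays in [0, 2].  As remainders differ by integers, rigidity
at a point w of (0, 1) other than 1/2 depends only on the side of 1/2 on which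
w lies: a must be [left_rigid] if w < 1/2 and [right_rigid] if w > 1/2.  The
digit 0 is always left rigid and n - 1 is always right rigid.

There are three ways to get a large family of rigid expansions.
- A left rigid digit a with 0 < a <= (n - 1) / 2: expansions with the digits 0
  and a that are not eventually constant have all tails in (0, 1/2).
- Symmetrically, a right rigid digit a with (n - 1) / 2 <= a < n - 1.
- A right rigid g < (n - 1) / 2 together with a left rigid h > (n - 1) / 2.
  Call 0 and g small, h and n - 1 big: 0 and h must be followed by a small
  digit, g and n - 1 by a big one.  Any sequence of sizes that is not
  eventually constant is realised by using 0, g, h, n - 1 for the transitions
  small-small, small-big, big-small, big-big.  Here g may be 0 and h may be
  n - 1.
In each case the digits are a function of two consecutive binary digits of a
parameter t in (0, 1).  The resulting map Z satisfies
Z t' - Z t >= c N^-k whenever t' - t > 2^-k ([coded_separation]), so its inverse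
is Hoelder continuous of exponent log 2 / log n.  Any cover of U_A thus gives a
cover of the irrationals of (0, 1), of Lebesgue measure 1, which bounds
the sum of the powers of the diameters from below ([hausdorff_dim_ge]).

If there are no such digits, then 2 v lies in U_A for no v in (0, 1)
([escape]).  When no small digit is right rigid, a tail below 1/2 forces the
digit 0 and another tail below 1/2 for ever, and so the tails grow like N^k,
which is absurd; hence all tails are at least 1/2, all digits are n - 1, and
1 minus the tail grows like N^k.  When no big digit is left rigid, the mirror
image of this applies.  Equality C + C = [0, 2] is what keeps the tails of v
away from 0 and 1 ([rigid0_eq], [rigid1_eq]).  *)

(** * Hausdorff dimension from a Hoelder parametrisation *)

Lemma diameter_ge {R : realType} (E : set R) x y :
  E x -> E y -> (`|x - y|%:E <= diameter E)%E.
Proof. by move=> Ex Ey; apply: ereal_sup_ubound; exists x => //; exists y. Qed.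

Lemma diameter_pow_ge0 {R : realType} (s : R) (E : set R) :
  (0 <= diameter_pow s E)%E.
Proof. by rewrite /diameter_pow; case: ifP => // _; exact: poweR_ge0. Qed.

Lemma powR_ge_exp {R : realType} (d r s : R) :
  0 <= d <= 1 -> 0 <= r <= s -> d `^ s <= d `^ r.
Proof.
move=> /andP[d0 d1] /andP[r0 rs]; have [->|dN0] := eqVneq d 0.
  rewrite /powR eqxx; have [r00|rN0] := eqVneq r 0; first by case: (s == 0).
  by rewrite gt_eqF // (lt_le_trans _ rs) // lt_neqAle eq_sym rN0.
by apply: ger_powR => //; rewrite d1 andbT lt_neqAle eq_sym dN0.
Qed.

(** An irrational parameter has binary digits that are not eventually constant;
leaving out the rationals costs nothing in Lebesgue measure. *)
Definition irrational_unit {R : realType} : set R :=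
  `]0, 1[ `\` range ratr.

Lemma measurable_range_ratr {R : realType} : measurable (range ratr : set R).
Proof.
apply: countable_measurable; first by move=> t; exact: measurable_set1.
by apply: card_le_trans (card_image_le _ _) _; exact: countableP.
Qed.

Lemma measurable_irrational_unit {R : realType} : measurable (@irrational_unit R).
Proof.
by apply: measurableD; [exact: measurable_itv | exact: measurable_range_ratr].
Qed.

Lemma lebesgue_measure_irrational_unit {R : realType} :
  lebesgue_measure (@irrational_unit R) = 1%E.
Proof.
have : lebesgue_measure (`]0, 1[%classic : set R) = 1%E.
  by rewrite lebesgue_measure_itv /= lte_fin ltr01 oppr0 adde0.
rewrite (@measureDI _ _ _ lebesgue_measure _ (range ratr)) //; last first.
  exact: measurable_range_ratr.
rewrite -/irrational_unit => <-; rewrite [X in (_ + X)%E](_ : _ = 0%E) ?adde0 //.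
apply: (@subset_measure0 _ _ _ lebesgue_measure _ (range ratr)) => //.
- by apply: measurableI; [exact: measurable_itv | exact: measurable_range_ratr].
- exact: measurable_range_ratr.
- exact: lebesgue_measure_rat.
Qed.

(** A set of the cover of diameter d meets the image of Z in points whose
parameters lie in an interval of length 2 c d^s.  These intervals cover a set
of measure 1, so the sum of the d^s is at least 1 / (2 c).  For r < s and
d <= 1 the powers d^r are at least as large, so the r-dimensional measure cannot
vanish. *)
Lemma hausdorff_dim_ge {R : realType} (s c : R) (E : set R) (Z : R -> R) :
  0 < c -> 0 <= s ->
  (forall t, irrational_unit t -> E (Z t)) ->
  (forall t t', irrational_unit t -> irrational_unit t' ->
     `|t - t'| <= c * `|Z t - Z t'| `^ s) ->
  (s%:E <= hausdorff_dim E)%E.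
Proof.
move=> c0 s0 EZ hold; apply: le_ereal_inf_tmp => _ [r [r0 Hr0]] <-.
rewrite lee_fin leNgt; apply/negP => rs.
suff : ((2 * c)^-1%:E <= hausdorff_measure r E)%E.
  by rewrite Hr0 lee_fin leNgt invr_gt0 mulr_gt0.
apply: (@le_trans _ _ (hausdorff_premeasure r 1 E)); last first.
  by apply: ereal_sup_ubound; exists 1 => //=; exact: ltr01.
apply: le_ereal_inf_tmp => _ [U [EU dU]] <-.
have cov k : exists I : set R, [/\ measurable I,
    (forall t, irrational_unit t -> U k (Z t) -> I t) &
    (lebesgue_measure I <= (2 * c)%:E * diameter_pow r (U k))%E].
  have [[t0 [Nt0 Ut0]]|none] := pselect (exists t, irrational_unit t /\ U k (Z t)).
    have dk := dU k.
    have d0 : (0%:E <= diameter (U k))%E.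
      by have := diameter_ge Ut0 Ut0; rewrite subrr normr0.
    have dfin : diameter (U k) \is a fin_num.
      by rewrite ge0_fin_numE // (le_lt_trans dk) // ltry.
    move: dk d0; rewrite -(fineK dfin); set d := fine _ => dk d0.
    have Ed : diameter (U k) = d%:E by rewrite fineK.
    rewrite !lee_fin in dk d0.
    exists `[t0 - c * d `^ s, t0 + c * d `^ s]%classic; split.
    - exact: measurable_itv.
    - move=> t Nt Ut; rewrite /= in_itv /= -ler_distlC; apply: (le_trans (hold _ _ Nt0 Nt)).
      rewrite ler_pM2l //; apply: ge0_ler_powR => //.
      by rewrite -lee_fin -Ed; exact: diameter_ge.
    - have dr : (diameter_pow r (U k) = (d `^ r)%:E)%E.
        rewrite /diameter_pow Ed poweR_EFin ifF //; apply/eqP => U0.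
        by move: Ut0; rewrite U0.
      rewrite dr lebesgue_measure_itv /= lte_fin.
      have pd := powR_ge0 d s.
      have pr : d `^ s <= d `^ r by apply: powR_ge_exp; rewrite ?d0 ?dk ?r0 ?ltW.
      case: ifP => _; rewrite -?EFinB -?EFinM lee_fin; nra.
  exists set0; split => //.
  - by move=> t Nt Ut; apply: none; exists t.
  - rewrite measure0 mule_ge0 ?diameter_pow_ge0 // lee_fin; lra.
have [I /all_and3[mI covI muI]] := choice cov.
have N1 := @lebesgue_measure_irrational_unit R.
have : (lebesgue_measure (@irrational_unit R) <= \sum_(0 <= k <oo) lebesgue_measure (I k))%E.
  apply: (measure_sigma_subadditive lebesgue_measure) => //.
  - exact: measurable_irrational_unit.
  - by move=> t Nt; have [k _ Uk] := EU _ (EZ _ Nt); exists k => //; exact: covI.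
rewrite N1 => le1.
have : (1 <= (2 * c)%:E * \sum_(0 <= k <oo) diameter_pow r (U k))%E.
  rewrite -nneseriesZl; last by move=> i _; exact: diameter_pow_ge0.
  apply: (le_trans le1); apply: lee_nneseries => // i _; exact: muI.
rewrite -lee_pdivrMl ?mulr_gt0 // mule1 //.
Qed.

(** * Expansions in a real base *)

Lemma natr_ge2 {R : realType} {n : nat} : (2 <= n)%N -> @Order.le _ R 2 n%:R.
Proof. by move=> n2; rewrite (ler_nat R 2 n). Qed.

Lemma geometric_unbounded {R : realType} (x N M : R) :
  2 <= N -> (forall k, N ^+ k * x <= M) -> x <= 0.
Proof.
move=> N2 bnd; rewrite leNgt; apply/negP => x0.
have [k Mk] : exists k, M / x < 2 ^+ k by eexists; apply: upper_nthrootP.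
have := bnd k; rewrite leNgt -ltr_pdivrMr // => /negP; apply.
by apply: (lt_le_trans Mk); rewrite lerXn2r ?nnegrE //; lra.
Qed.

Definition digit_val {R : realType} (N : R) (a : nat -> R) : R :=
  limn (series (fun i => a i * N ^- i.+1)).

Definition digits {R : realType} (N : R) (a : nat -> R) :=
  forall i, 0 <= a i <= N - 1.

Lemma cvg_constant_digit {R : realType} (N c : R) : 2 <= N ->
  series (fun i => (N - 1) * c * N ^- i.+1) @ \oo --> c.
Proof.
move=> N2; have [N1 N0] : 1 < N /\ 0 < N by split; lra.
have Ninv : `|N^-1| < 1 by rewrite ger0_norm ?invr_ge0 ?invf_lt1 // ltW.
have := cvg_geometric_series (a := (N - 1) * c / N) Ninv.
rewrite (_ : _ / (1 - _) = c); last by field; rewrite !gt_eqF //; lra.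
rewrite (_ : series _ = series (fun i => (N - 1) * c * N ^- i.+1)) //.
by congr series; apply/funext => i /=; rewrite -exprVn exprS mulrA.
Qed.

Lemma cvg_digit_val {R : realType} (N : R) a : 2 <= N -> digits N a ->
  series (fun i => a i * N ^- i.+1) @ \oo --> digit_val N a.
Proof.
move=> N2 da; have N0 : 0 <= N by lra.
apply: (series_le_cvg (v_ := fun i => (N - 1) * 1 * N ^- i.+1)).
- by move=> i; have /andP[a0 _] := da i; rewrite mulr_ge0 // invr_ge0 exprn_ge0.
- by move=> i; rewrite mulr_ge0 ?invr_ge0 ?exprn_ge0 //; lra.
- move=> i; have /andP[_ a1] := da i.
  by rewrite mulr1; apply: ler_wpM2r => //; rewrite invr_ge0 exprn_ge0.
- by apply: cvgP; exact: cvg_constant_digit.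
Qed.

Lemma digit_valS {R : realType} (N : R) a : 2 <= N -> digits N a ->
  N * digit_val N a = a 0%N + digit_val N (fun i => a i.+1).
Proof.
move=> N2 da; have da' : digits N (fun i => a i.+1) by move=> i; exact: da.
have NN0 : N != 0 by rewrite gt_eqF //; lra.
have E k : N * series (fun i => a i * N ^- i.+1) k.+1 =
    a 0%N + series (fun i => a i.+1 * N ^- i.+1) k.
  rewrite /series /= big_nat_recl //= mulrDr [N * (_ / _)]mulrC mulfVK //.
  congr (_ + _); rewrite mulr_sumr; apply: eq_bigr => i _.
  by rewrite exprS invfM mulrCA [N * _]mulrA mulfV // mul1r.
have rhs : (fun k => a 0%N + series (fun i => a i.+1 * N ^- i.+1) k) @ \oo -->
    a 0%N + digit_val N (fun i => a i.+1).
  by apply: cvgD; [exact: cvg_cst | exact: cvg_digit_val].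
have lhs : (fun k => N * series (fun i => a i * N ^- i.+1) k) @ \oo -->
    N * digit_val N a.
  by apply: cvgM; [exact: cvg_cst | exact: cvg_digit_val].
rewrite -cvg_shiftS in lhs.
rewrite -[LHS](cvg_lim _ lhs) // -[RHS](cvg_lim _ rhs) //.
by congr (limn _); apply/funext => k /=; rewrite E.
Qed.

(** Compare with the constant expansions of digit (N - 1) m and (N - 1) M. *)
Lemma digit_val_bounds {R : realType} (N : R) a m M : 2 <= N -> digits N a ->
  (forall i, (N - 1) * m <= a i <= (N - 1) * M) ->
  m <= digit_val N a <= M.
Proof.
move=> N2 da bnd; have ca := cvg_digit_val N2 da.
have cm := cvg_constant_digit (c := m) N2; have cM := cvg_constant_digit (c := M) N2.
have N0 : 0 <= N by lra.
have pw i : 0 <= N ^- i.+1 by rewrite invr_ge0 exprn_ge0.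
apply/andP; split; [rewrite -(cvg_lim _ cm) // | rewrite -(cvg_lim _ cM) //].
- apply: lim_series_le; [exact: cvgP cm|exact: cvgP ca|move=> i].
  by apply: ler_wpM2r => //; case/andP: (bnd i).
- apply: lim_series_le; [exact: cvgP ca|exact: cvgP cM|move=> i].
  by apply: ler_wpM2r => //; case/andP: (bnd i).
Qed.

(** * Self-similarity and sums with a single decomposition *)

(** The part of the self-similarity of C_A that the argument needs; expansions are
not mentioned, so points of C can be followed through their successive
tails. *)
Definition digit_attractor {R : realType} (N : R) (A : set int) (C : set R) :=
  [/\ forall v, C v -> 0 <= v <= 1,
      forall v, C v -> exists a w, [/\ A a, C w & N * v = a%:~R + w] &
      forall v a w, A a -> C w -> N * v = a%:~R + w -> C v].

Lemma digits_intr {R : realType} (n : nat) (A : set int) (a : nat -> int) :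
  A `<=` [set a | 0 <= a <= n%:Z - 1] -> (forall i, A (a i)) ->
  digits (n%:R : R) (fun i => (a i)%:~R).
Proof.
move=> An Aa i; have /andP[a0 a1] := An _ (Aa i).
rewrite ler0z a0 /=; rewrite -(ler_int R) intrB in a1; exact: a1.
Qed.

Lemma cantor_digit_val {R : realType} (n : nat) (A : set int) (a : nat -> int) :
  (2 <= n)%N -> A `<=` [set a | 0 <= a <= n%:Z - 1] -> (forall i, A (a i)) ->
  cantor_sum_set R n A (digit_val n%:R (fun i => (a i)%:~R)).
Proof.
move=> n2 An Aa; exists a => //.
exact: cvg_digit_val (natr_ge2 n2) (digits_intr An Aa).
Qed.

Lemma cantorP {R : realType} (n : nat) (A : set int) (v : R) :
  cantor_sum_set R n A v ->
  exists2 a : nat -> int, (forall i, A (a i)) &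
    v = digit_val n%:R (fun i => (a i)%:~R).
Proof. by case=> a Aa av; exists a => //; apply/esym/cvg_lim. Qed.

Lemma cantor_attractor {R : realType} (n : nat) (A : set int) :
  (2 <= n)%N -> A `<=` [set a | 0 <= a <= n%:Z - 1] ->
  digit_attractor (n%:R : R) A (cantor_sum_set R n A).
Proof.
move=> n2 An; have N2 := natr_ge2 (R := R) n2; split.
- move=> v /cantorP[a Aa ->]; apply: digit_val_bounds => //.
    exact: digits_intr An Aa.
  by move=> i; rewrite mulr0 mulr1; exact: digits_intr An Aa i.
- move=> v /cantorP[a Aa ->]; exists (a 0%N).
  exists (digit_val n%:R (fun i => (a i.+1)%:~R)); split => //.
    by apply: cantor_digit_val.
  by rewrite digit_valS //; exact: digits_intr An Aa.
- move=> v a w Aa /cantorP[b Ab ->] Nv.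
  pose c i := if i is j.+1 then b j else a.
  have Ac i : A (c i) by case: i.
  suff -> : v = digit_val n%:R (fun i => (c i)%:~R) by exact: cantor_digit_val.
  have NN0 : n%:R != 0 :> R by rewrite pnatr_eq0; case: (n) n2.
  apply: (mulfI NN0); rewrite Nv digit_valS //; exact: digits_intr An Ac.
Qed.

(** The halves of the points of the set of uniqueness, see [uniqueness_setP]. *)
Definition unique_half {R : realType} (C : set R) : set R :=
  [set v | C v /\ forall x y, C x -> C y -> x + y = 2 * v -> x = v /\ y = v].

Lemma uniqueness_setP {R : realType} (n : nat) (A : set int) (v : R) :
  uniqueness_set R n A (2 * v) <-> unique_half (cantor_sum_set R n A) v.
Proof.
set C := cantor_sum_set R n A; split.
- case=> _ [[x y] [[/= [Cx Cy] vxy] uniq]].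
  (* the swapped pair is another decomposition, hence equal to the first *)
  have [xy _] : (x, y) = (y, x) by apply: uniq; rewrite /= addrC.
  have xv : x = v by lra.
  split => [|x' y' Cx' Cy' x'y']; first by rewrite -xv.
  have [<- <-] : (x, y) = (x', y') by apply: uniq.
  by split; lra.
- case=> Cv uniq; split; first by exists v => //; exists v => //; rewrite mulr2n mulrDl mul1r.
  exists (v, v); split; first by split => //=; rewrite mulr2n mulrDl mul1r.
  by move=> [x y] [/= [Cx Cy] /esym/uniq[]] // -> ->.
Qed.

Definition rigid {R : realType} (A : set int) (a : int) (v : R) :=
  forall b c, A b -> A c ->
  0 <= 2 * a%:~R - b%:~R - c%:~R + 2 * v <= 2 -> b = a /\ c = a.

(** Only the sums b + c for which the remainder 2 w + 2 a - b - c can lie in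
[0, 2] matter: for 0 < w < 1/2 these are 2 a and 2 a - 1, for 1/2 < w < 1 they
are 2 a and 2 a + 1. *)
Definition left_rigid (A : set int) (a : int) :=
  forall b c, A b -> A c -> b + c = 2 * a \/ b + c = 2 * a - 1 -> b = a /\ c = a.

Definition right_rigid (A : set int) (a : int) :=
  forall b c, A b -> A c -> b + c = 2 * a \/ b + c = 2 * a + 1 -> b = a /\ c = a.

Lemma rigid_of_left {R : realType} A a (v : R) :
  left_rigid A a -> 0 < v < 2^-1 -> rigid A a v.
Proof.
move=> La /andP[v0 v1] b c Ab Ac /andP[lo hi]; apply: La => //.
have h1 : (2 * a - b - c < 2)%R by rewrite -(ltr_int R); lra.
have h2 : (-1 < 2 * a - b - c)%R by rewrite -(ltr_int R); lra.
lia.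
Qed.

Lemma rigid_of_right {R : realType} A a (v : R) :
  right_rigid A a -> 2^-1 < v < 1 -> rigid A a v.
Proof.
move=> La /andP[v0 v1] b c Ab Ac /andP[lo hi]; apply: La => //.
have h1 : (2 * a - b - c < 1)%R by rewrite -(ltr_int R); lra.
have h2 : (-2 < 2 * a - b - c)%R by rewrite -(ltr_int R); lra.
lia.
Qed.

Lemma left_of_rigid {R : realType} A a (v : R) :
  rigid A a v -> 0 <= v <= 2^-1 -> left_rigid A a.
Proof.
move=> ra /andP[v0 v1] b c Ab Ac [|] /(congr1 (fun x : int => x%:~R : R)) bc;
  apply: ra => //; rewrite !(intrD, intrM, intrB) in bc; apply/andP; split; lra.
Qed.

Lemma right_of_rigid {R : realType} A a (v : R) :
  rigid A a v -> 2^-1 <= v <= 1 -> right_rigid A a.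
Proof.
move=> ra /andP[v0 v1] b c Ab Ac [|] /(congr1 (fun x : int => x%:~R : R)) bc;
  apply: ra => //; rewrite !(intrD, intrM, intrB) in bc; apply/andP; split; lra.
Qed.

Section attractor_sums.
Context {R : realType} {N : R} {A : set int} {C : set R}.
Implicit Types (v w : R) (a b c : int).

(** If x + y = 2 v, rigidity forces x and y to start with the digit of v, so
|x - v| is 1 / N times the same distance for the tails, which is again at most
1; iterating, |x - v| <= N^-k for all k. *)
Lemma unique_half_coinduction (W : set R) :
  2 <= N -> digit_attractor N A C -> W `<=` C ->
  (forall v, W v -> exists a w, [/\ A a, W w, N * v = a%:~R + w & rigid A a w]) ->
  W `<=` unique_half C.
Proof.
move=> N2 [C01 CS _] WC Wstep v Wv; split; first exact: WC.
have dist k : forall v x y, W v -> C x -> C y -> x + y = 2 * v ->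
    N ^+ k * `|x - v| <= 1.
  elim: k => [{v Wv}v x y Wv Cx Cy _|k IH {v Wv}v x y Wv Cx Cy xy].
    have := C01 _ Cx; have := C01 _ (WC _ Wv).
    by rewrite expr0 mul1r ler_norml => /andP[? ?] /andP[? ?]; apply/andP; split; lra.
  have [a [w [Aa Ww Nv ra]]] := Wstep _ Wv.
  have [b [x' [Ab Cx' Nx]]] := CS _ Cx.
  have [c [y' [Ac Cy' Ny]]] := CS _ Cy.
  have sumN : b%:~R + x' + (c%:~R + y') = 2 * (a%:~R + w).
    by rewrite -Nx -Ny -Nv -mulrDr xy mulrCA.
  have := C01 _ Cx'; have := C01 _ Cy' => /andP[? ?] /andP[? ?].
  have [ba ca] : b = a /\ c = a by apply: ra => //; apply/andP; split; lra.
  have -> : N ^+ k.+1 * `|x - v| = N ^+ k * `|x' - w|.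
    rewrite exprSr -mulrA -[X in X * `|_|]ger0_norm ?(le_trans _ N2) //.
    by rewrite -normrM mulrBr Nx Nv ba; congr (_ * `|_|); lra.
  by apply: (IH w x' y') => //; rewrite ba ca in sumN; lra.
have eqv x y : C x -> C y -> x + y = 2 * v -> x = v.
  move=> Cx Cy xy; apply/eqP; rewrite -subr_eq0 -normr_le0.
  by apply: (geometric_unbounded N2) => k; exact: dist Wv Cx Cy xy.
move=> x y Cx Cy xy; split; first exact: eqv Cx Cy xy.
by apply: (eqv y x) => //; rewrite addrC.
Qed.

(** Rigidity is a statement on digits, while uniqueness is one on points, and a
point of C may have two expansions.  Such a point v is ruled out, because its
two expansions can be recombined into another decomposition of 2 v. *)
Lemma unique_half_step v :
  2 <= N -> digit_attractor N A C ->
  (forall u, 0 <= u <= 2 -> exists x y, [/\ C x, C y & x + y = u]) ->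
  unique_half C v ->
  exists a w, [/\ A a, unique_half C w, N * v = a%:~R + w & rigid A a w].
Proof.
move=> N2 [C01 CS Croll] Csum [Cv uniq].
have [a [w [Aa Cw Nv]]] := CS _ Cv.
have key b c x y : A b -> A c -> C x -> C y ->
    b%:~R + x + (c%:~R + y) = 2 * (a%:~R + w) ->
    b%:~R + x = a%:~R + w /\ c%:~R + y = a%:~R + w.
  move=> Ab Ac Cx Cy sumN; have NN0 : N != 0 by rewrite gt_eqF //; lra.
  have E u : N * (u / N) = u by rewrite mulrC mulfVK.
  have [] := uniq ((b%:~R + x) / N) ((c%:~R + y) / N).
  - exact: Croll Ab Cx (E _).
  - exact: Croll Ac Cy (E _).
  - by apply: (mulfI NN0); rewrite mulrDr !E sumN mulrCA Nv.
  - by move=> /(congr1 ( *%R N)) + /(congr1 ( *%R N)); rewrite !E Nv.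
have [C0 C1] : C 0 /\ C 1.
  split.
    have [x [y [Cx Cy xy]]] : exists x y, [/\ C x, C y & x + y = 0].
      by apply: Csum; rewrite lexx; lra.
    have /andP[x0 _] := C01 _ Cx; have /andP[y0 _] := C01 _ Cy.
    by have <- : x = 0 by lra.
  have [x [y [Cx Cy xy]]] : exists x y, [/\ C x, C y & x + y = 2].
    by apply: Csum; rewrite lexx; lra.
  have /andP[_ x0] := C01 _ Cx; have /andP[_ y0] := C01 _ Cy.
  by have <- : x = 1 by lra.
have /andP[w0 w1] := C01 _ Cw.
(* If b + x = a + w with b <> a, then b = a + 1, x = 0, w = 1 or b = a - 1,
   x = 1, w = 0.  As 0 and 1 lie in C, in both cases
   (min a b + 0) + (max a b + 1) is another decomposition of 2 (a + w). *)
have digit b x : A b -> C x -> b%:~R + x = a%:~R + w -> b = a.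
  move=> Ab Cx bx; have /andP[x0 x1] := C01 _ Cx.
  have lo : (b - a <= 1)%R by rewrite -(ler_int R) intrB; lra.
  have hi : (-1 <= b - a)%R by rewrite -(ler_int R) intrB; lra.
  have [//|[ba|ba]] : b = a \/ b = a + 1 \/ b = a - 1 by lia.
  - have bR : b%:~R = a%:~R + 1 :> R by rewrite ba intrD.
    have [|e _] := key a b 0 1 Aa Ab C0 C1; first by lra.
    by exfalso; lra.
  - have bR : b%:~R = a%:~R - 1 :> R by rewrite ba intrB.
    have [|_ e] := key b a 0 1 Ab Aa C0 C1; first by lra.
    by exfalso; lra.
exists a, w; split => //.
- split=> // x y Cx Cy xy; have [] := key a a x y Aa Aa Cx Cy; first by lra.
  by move=> ? ?; split; lra.
- move=> b c Ab Ac bc.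
  have [x [y [Cx Cy xy]]] := Csum _ bc.
  have [bx cy] := key b c x y Ab Ac Cx Cy ltac:(lra).
  by split; [exact: digit bx | exact: digit cy].
Qed.

End attractor_sums.

(** * Coding by the doubling map *)

Lemma powR_ln2_div_ln {R : realType} (N : R) : 2 <= N -> N `^ (ln 2 / ln N) = 2.
Proof.
move=> N2; have lnN : ln N != 0 by rewrite gt_eqF // ln_gt0; lra.
rewrite /powR gt_eqF; last lra.
by rewrite mulfVK // lnK // posrE.
Qed.

Lemma pow2_lt {R : realType} (x : R) : 0 < x -> exists k, 2 ^- k < x.
Proof.
move=> x0; have [k Mk] : exists k, x^-1 < 2 ^+ k by eexists; apply: upper_nthrootP.
by exists k; rewrite -[ltRHS]invrK ltf_pV2 ?posrE ?exprn_gt0 ?invr_gt0.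
Qed.

(** With s = ln 2 / ln N one has (N^-k)^s = 2^-k, so taking the least k with
2^-k < t' - t turns the separation into a Hoelder bound. *)
Lemma hausdorff_dim_ge_of_separation {R : realType} (N c : R) (E : set R) (Z : R -> R) :
  2 <= N -> 0 < c ->
  (forall t, irrational_unit t -> E (Z t)) ->
  (forall k t t', irrational_unit t -> irrational_unit t' ->
     2 ^- k < t' - t -> c * N ^- k <= Z t' - Z t) ->
  ((ln 2 / ln N)%:E <= hausdorff_dim E)%E.
Proof.
move=> N2 c0 EZ sep; set s := ln 2 / ln N.
have lnN : 0 < ln N by rewrite ln_gt0; lra.
have s0 : 0 <= s by rewrite divr_ge0 ?ln_ge0 //; lra.
apply: (@hausdorff_dim_ge _ s (2 * c^-1 `^ s) E Z) => //.
  by rewrite mulr_gt0 // powR_gt0 ?invr_gt0.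
suff main t t' : irrational_unit t -> irrational_unit t' -> t < t' ->
    t' - t <= 2 * c^-1 `^ s * `|Z t' - Z t| `^ s.
  move=> t t' it it'; have [tt'|tt'|->] := ltgtP t t'.
  - by rewrite distrC (distrC (Z t)) gtr0_norm ?subr_gt0 //; exact: main.
  - by rewrite gtr0_norm ?subr_gt0 //; exact: main.
  - by rewrite subrr normr0 mulr_ge0 ?powR_ge0 // mulr_ge0 ?powR_ge0.
move=> it it' tt'.
have ex := pow2_lt (etrans (subr_gt0 _ _) tt').
case: (ex_minnP ex) => -[|k] kT kmin.
  have /andP[t0 t1] : 0 < t < 1 by have [] := it; rewrite /= in_itv.
  have /andP[t0' t1'] : 0 < t' < 1 by have [] := it'; rewrite /= in_itv.
  by move: kT; rewrite expr0 invr1 => ?; exfalso; lra.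
have Tk : t' - t <= 2 ^- k.
  by rewrite leNgt; apply/negP => /kmin; rewrite ltnn.
have := sep _ _ _ it it' kT; have Nk0 : 0 < N ^+ k.+1 by rewrite exprn_gt0 //; lra.
set D := Z t' - Z t => cD.
have D0 : 0 < D by apply: lt_le_trans cD; rewrite mulr_gt0 // invr_gt0.
have one : 1 <= (c^-1 * D) * N ^+ k.+1.
  by rewrite -ler_pdivrMr // mul1r ler_pdivlMl.
have : 1 <= ((c^-1 * D) * N ^+ k.+1) `^ s.
  have -> : 1 = 1 `^ s by rewrite powR1.
  apply: ge0_ler_powR; rewrite ?nnegrE //.
  by rewrite ltW // mulr_gt0 // mulr_gt0 // invr_gt0.
have Ns : (N ^+ k.+1) `^ s = 2 ^+ k.+1.
  rewrite -powR_mulrn; last lra.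
  by rewrite -powRrM mulrC powRrM powR_ln2_div_ln // powR_mulrn.
have cDs : (c^-1 * D) `^ s = c^-1 `^ s * D `^ s by rewrite powRM // ?invr_ge0 ltW.
have cD0 : 0 <= c^-1 * D by rewrite ltW // mulr_gt0 // invr_gt0.
rewrite powRM ?(ltW Nk0) // cDs Ns gtr0_norm // => one2; apply: (le_trans Tk).
rewrite -ler_pdivrMr ?exprn_gt0 // mul1r exprS invfM in one2.
by rewrite -mulrA -ler_pdivrMl.
Qed.

Definition bit {R : realType} (t : R) : bool := 2^-1 <= t.

Definition doubling {R : realType} (t : R) : R := 2 * t - (bit t)%:R.

Lemma irrational_unitP {R : realType} (t : R) : irrational_unit t -> 0 < t < 1.
Proof. by case; rewrite /= in_itv. Qed.

(** The endpoint 0, reached from t = 1/2, is rational. *)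
Lemma irrational_doubling {R : realType} (t : R) :
  irrational_unit t -> irrational_unit (doubling t).
Proof.
move=> it; have /andP[t0 t1] := irrational_unitP it; case: it => _ tQ.
have nQ : ~ range ratr (doubling t).
  case=> q _ qt; apply: tQ; exists ((q + (bit t)%:R) / 2) => //.
  by rewrite fmorph_div rmorphD /= !rmorph_nat qt /doubling; lra.
split=> //; rewrite /= in_itv /=.
have D0 : doubling t != 0.
  by apply/eqP => d0; apply: nQ; exists 0; rewrite // d0 rmorph0.
move: D0; rewrite /doubling /bit; case: (leP 2^-1 t) => /= h D0;
  apply/andP; split; lra.
Qed.

(** The binary digits of t are the [bit]s along its orbit under [doubling]; two
consecutive ones select a digit through f.  With this form the shift of an
expansion is the action of [doubling] on the parameter. *)
Definition coded {R : realType} (N : R) (f : bool -> bool -> int) (t : R) : R :=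
  digit_val N (fun k =>
    (f (bit (iter k doubling t)) (bit (iter k.+1 doubling t)))%:~R).

Lemma codedS {R : realType} (N : R) f t : 2 <= N ->
  (forall b b', 0 <= f b b') -> (forall b b', (f b b')%:~R <= N - 1) ->
  N * coded N f t = (f (bit t) (bit (doubling t)))%:~R + coded N f (doubling t).
Proof.
move=> N2 f0 f1; rewrite /coded digit_valS //; last first.
  by move=> i; rewrite ler0z f0 f1.
by do 2?congr (_ + _); congr digit_val; apply/funext => k; rewrite -!iterSr.
Qed.

Lemma coded_bounds {R : realType} (N m M : R) f t : 2 <= N ->
  (forall b b', 0 <= f b b') -> (forall b b', (f b b')%:~R <= N - 1) ->
  (forall b b', (N - 1) * m <= (f b b')%:~R <= (N - 1) * M) ->
  m <= coded N f t <= M.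
Proof.
move=> N2 f0 f1 fmM; apply: digit_val_bounds => // i.
by rewrite ler0z f0 f1.
Qed.

(** If t > 2^-k, one of the first k binary digits of t is 1; at that place Z
exceeds m by c, and each earlier digit divides the excess by N at worst. *)
Lemma coded_low {R : realType} (N m c : R) (F Z : R -> R) : 2 <= N -> 0 <= c ->
  (forall t, irrational_unit t -> N * Z t = F t + Z (doubling t)) ->
  (forall t, (N - 1) * m <= F t) ->
  (forall t, irrational_unit t -> bit t -> m + c <= Z t) ->
  forall k t, irrational_unit t -> 2 ^- k < t -> m + c * N ^- k <= Z t.
Proof.
move=> N2 c0 ZS Fm Zc; elim=> [|k IH] t it kt.
  by have /andP[_ t1] := irrational_unitP it; move: kt; rewrite expr0 invr1 => ?; exfalso; lra.
have N0 : 0 < N by lra.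
have [bt|bt] := boolP (bit t).
  apply: le_trans (Zc _ it bt); rewrite lerD2l ler_piMr // invf_le1 ?exprn_gt0 //.
  by apply: exprn_ege1; lra.
have dt : doubling t = 2 * t by rewrite /doubling (negbTE bt) subr0.
have := IH _ (irrational_doubling it); rewrite dt => IHt.
have {}IHt : m + c * N ^- k <= Z (2 * t).
  by apply: IHt; rewrite exprS invfM in kt; lra.
rewrite -(ler_pM2l N0) ZS // dt exprS invfM.
have -> : N * (m + c * (N^-1 * N ^- k)) = (N - 1) * m + (m + c * N ^- k).
  by field; rewrite ?gt_eqF ?exprn_gt0.
by have := Fm t; lra.
Qed.

Lemma coded_high {R : realType} (N M c : R) (F Z : R -> R) : 2 <= N -> 0 <= c ->
  (forall t, irrational_unit t -> N * Z t = F t + Z (doubling t)) ->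
  (forall t, F t <= (N - 1) * M) ->
  (forall t, irrational_unit t -> ~~ bit t -> Z t <= M - c) ->
  forall k t, irrational_unit t -> 2 ^- k < 1 - t -> Z t <= M - c * N ^- k.
Proof.
move=> N2 c0 ZS Fm Zc; elim=> [|k IH] t it kt.
  by have /andP[t1 _] := irrational_unitP it; move: kt; rewrite expr0 invr1 => ?; exfalso; lra.
have N0 : 0 < N by lra.
have [bt|bt] := boolP (bit t); last first.
  apply: (le_trans (Zc _ it bt)); rewrite lerD2l lerN2 ler_piMr // invf_le1 ?exprn_gt0 //.
  by apply: exprn_ege1; lra.
have dt : doubling t = 2 * t - 1 by rewrite /doubling bt.
have := IH _ (irrational_doubling it); rewrite dt => IHt.
have {}IHt : Z (2 * t - 1) <= M - c * N ^- k.
  by apply: IHt; rewrite exprS invfM in kt; lra.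
rewrite -(ler_pM2l N0) ZS // dt exprS invfM.
have -> : N * (M - c * (N^-1 * N ^- k)) = (N - 1) * M + (M - c * N ^- k).
  by field; rewrite ?gt_eqF ?exprn_gt0.
by have := Fm t; lra.
Qed.

(** As long as the binary digits of t and t' agree, one step doubles t' - t and
multiplies Z t' - Z t by at most N, since f is monotone in the following digit.
Thus separation has to be checked only for first digits 0 and 1. *)
Lemma coded_separation {R : realType} (N c : R) (f : bool -> bool -> int) (Z : R -> R) :
  2 <= N ->
  (forall b, f b false <= f b true) ->
  (forall t, irrational_unit t ->
     N * Z t = (f (bit t) (bit (doubling t)))%:~R + Z (doubling t)) ->
  (forall k t t', irrational_unit t -> irrational_unit t' -> ~~ bit t -> bit t' ->
     2 ^- k < t' - t -> c * N ^- k <= Z t' - Z t) ->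
  forall k t t', irrational_unit t -> irrational_unit t' ->
     2 ^- k < t' - t -> c * N ^- k <= Z t' - Z t.
Proof.
move=> N2 fmono ZS sep; elim=> [|k IH] t t' it it' kT.
  have /andP[t0 t1] := irrational_unitP it; have /andP[t0' t1'] := irrational_unitP it'.
  by move: kT; rewrite expr0 invr1 => ?; exfalso; lra.
have tt' : t < t' by rewrite -subr_gt0; apply: lt_trans kT; rewrite invr_gt0 exprn_gt0.
have bmono (u u' : R) : u < u' -> bit u -> bit u' by rewrite /bit => ? ?; lra.
have [bb|bb] := eqVneq (bit t) (bit t'); last first.
  have := bmono _ _ tt'; case bt: (bit t) bb; case bt': (bit t') => // _.
    by move/(_ isT).
  by move=> _; apply: sep => //; rewrite ?bt ?bt'.
have dd : doubling t' - doubling t = 2 * (t' - t) by rewrite /doubling bb; lra.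
have N0 : 0 < N by lra.
have IHt : c * N ^- k <= Z (doubling t') - Z (doubling t).
  apply: IH; [exact: irrational_doubling|exact: irrational_doubling|].
  by rewrite dd; rewrite exprS invfM in kT; lra.
have ff : f (bit t) (bit (doubling t)) <= f (bit t') (bit (doubling t')).
  rewrite bb; have := bmono (doubling t) (doubling t').
  have -> : doubling t < doubling t' by rewrite -subr_gt0 dd; lra.
  by case: (bit (doubling t)); case: (bit (doubling t')) => // /(_ isT isT).
rewrite -(ler_int R) in ff.
rewrite -(ler_pM2l N0) mulrBr !ZS // exprS invfM.
have -> : N * (c * (N^-1 * N ^- k)) = c * N ^- k.
  by field; rewrite ?gt_eqF ?exprn_gt0.
lra.
Qed.

(** * Pairs of digits giving large sets of uniqueness *)

Lemma good_decomposition {R : realType} (N : R) A C (top : int) :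
  2 <= N -> N = top%:~R + 1 -> digit_attractor N A C ->
  minkowski_sum C C = `[0, 2]%classic -> forall u, 0 <= u <= 2 * N ->
  exists b c x, [/\ A b, A c, 0 <= x <= 2 & u = b%:~R + c%:~R + x].
Proof.
move=> N2 Ntop [C01 CS _] CC u /andP[u0 u1].
have N0 : 0 < N by lra.
have : minkowski_sum C C (u / N).
  rewrite CC /= in_itv /= divr_ge0 //=; last by rewrite ltW.
  by rewrite ler_pdivrMr.
case=> x Cx [y Cy xy].
have [b [x' [Ab Cx' Nx]]] := CS _ Cx.
have [c [y' [Ac Cy' Ny]]] := CS _ Cy.
have /andP[? ?] := C01 _ Cx'; have /andP[? ?] := C01 _ Cy'.
exists b, c, (x' + y'); split => //; first by apply/andP; split; lra.
have : N * (x + y) = u by rewrite xy mulrC divfK // gt_eqF.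
by rewrite mulrDr Nx Ny; lra.
Qed.

(** For a > 0 the point (2 a - 1/2) / N of [0, 2] is a sum of two points of C,
whose digits b, c satisfy b + c = 2 a - 1 or 2 a - 2; either sum violates
rigidity at 0. *)
Lemma rigid0_eq {R : realType} (N : R) A C (top a : int) :
  2 <= N -> N = top%:~R + 1 -> digit_attractor N A C ->
  minkowski_sum C C = `[0, 2]%classic -> 0 <= a <= top ->
  rigid A a (0 : R) -> a = 0.
Proof.
move=> N2 Ntop CA CC /andP[a0 atop] ra; apply/eqP; apply: contraT => aN0.
have aR1 : 1%:~R <= a%:~R :> R by rewrite ler_int; lia.
have aRt : a%:~R <= top%:~R :> R by rewrite ler_int.
have [b [c [x [Ab Ac /andP[x0 x2] u]]]] :=
  good_decomposition N2 Ntop CA CC (u := 2 * a%:~R - 2^-1) ltac:(apply/andP; split; lra).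
have hi : (2 * a - b - c < 3)%R by rewrite -(ltr_int R); lra.
have {}hi : (2 * a - b - c <= 2)%R by lia.
rewrite -(ler_int R) in hi.
have [ba ca] : b = a /\ c = a by apply: ra => //; apply/andP; split; lra.
by exfalso; rewrite ba ca in u; lra.
Qed.

Lemma rigid1_eq {R : realType} (N : R) A C (top a : int) :
  2 <= N -> N = top%:~R + 1 -> digit_attractor N A C ->
  minkowski_sum C C = `[0, 2]%classic -> 0 <= a <= top ->
  rigid A a (1 : R) -> a = top.
Proof.
move=> N2 Ntop CA CC /andP[a0 atop] ra; apply/eqP; apply: contraT => aN0.
have aR1 : 0%:~R <= a%:~R :> R by rewrite ler_int.
have aRt : (a + 1)%:~R <= top%:~R :> R by rewrite ler_int; lia.
have [b [c [x [Ab Ac /andP[x0 x2] u]]]] :=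
  good_decomposition N2 Ntop CA CC (u := 2 * a%:~R + 2 + 2^-1) ltac:(apply/andP; split; lra).
have lo : (-1 < 2 * a - b - c + 2)%R by rewrite -(ltr_int R); lra.
have {}lo : (0 <= 2 * a - b - c + 2)%R by lia.
rewrite -(ler_int R) in lo.
have [ba ca] : b = a /\ c = a by apply: ra => //; apply/andP; split; lra.
by exfalso; rewrite ba ca in u; lra.
Qed.

Lemma dim_uniqueness_set_ge {R : realType} (n : nat) A (c : R) (f : bool -> bool -> int) :
  (2 <= n)%N -> A `<=` [set a | 0 <= a <= n%:Z - 1] -> 0 < c ->
  (forall b b', A (f b b')) -> (forall b, f b false <= f b true) ->
  (forall t, irrational_unit t ->
     rigid A (f (bit t) (bit (doubling t))) (coded (n%:R : R) f (doubling t))) ->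
  (forall k t t', irrational_unit t -> irrational_unit t' -> ~~ bit t -> bit t' ->
     2 ^- k < t' - t -> c * n%:R ^- k <= coded n%:R f t' - coded n%:R f t) ->
  ((ln 2 / ln n%:R)%:E <= hausdorff_dim (uniqueness_set R n A))%E.
Proof.
move=> n2 An c0 Af fmono frigid sep.
have N2 := natr_ge2 (R := R) n2.
have f0 b b' : 0 <= f b b' by case/andP: (An _ (Af b b')).
have f1 b b' : (f b b')%:~R <= n%:R - 1 :> R.
  by have /andP[_ h] := An _ (Af b b'); rewrite -(ler_int R) intrB in h.
apply: (@hausdorff_dim_ge_of_separation _ n%:R c _ (fun t => 2 * coded n%:R f t)) => //.
- move=> t it; apply/uniqueness_setP.
  apply: (unique_half_coinduction (W := [set coded n%:R f t | t in irrational_unit]) N2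
    (cantor_attractor n2 An)); last by exists t.
    by move=> _ [u _ <-]; exact: (cantor_digit_val n2 An).
  move=> _ [u iu <-]; exists (f (bit u) (bit (doubling u))), (coded n%:R f (doubling u)).
  split => //; last exact: frigid.
    by exists (doubling u) => //; exact: irrational_doubling.
  exact: codedS.
- move=> k t t' it it' kT.
  have codeS u : irrational_unit u -> n%:R * coded n%:R f u =
      (f (bit u) (bit (doubling u)))%:~R + coded (n%:R : R) f (doubling u).
    by move=> _; exact: codedS.
  have := coded_separation N2 fmono codeS sep it it' kT.
  have : 0 <= c * n%:R ^- k by rewrite mulr_ge0 ?invr_ge0 ?exprn_ge0 // ltW.
  lra.
Qed.

(** The numbers m and M are the values of the constant expansions a, a, ... and
a', a', ...; an irrational parameter gives an expansion using both digits, hence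
a point strictly between them. *)
Lemma dim_of_two_digits {R : realType} (n : nat) A (a a' : int) (m M : R) :
  (2 < n)%N -> A `<=` [set a | 0 <= a <= n%:Z - 1] ->
  A a -> A a' -> a < a' -> (n%:R - 1) * m = a%:~R -> (n%:R - 1) * M = a'%:~R ->
  (forall v, m < v < M -> rigid A a v /\ rigid A a' v) ->
  ((ln 2 / ln n%:R)%:E <= hausdorff_dim (uniqueness_set R n A))%E.
Proof.
move=> n3 An Aa Aa' aa' am aM ra; have n2 := ltnW n3.
pose f (b b' : bool) : int := if b then a' else a.
have N2 := natr_ge2 (R := R) n2.
have N3 : @Order.le _ R 3 n%:R by rewrite (ler_nat R 3 n).
set N : R := n%:R in N2 N3 am aM *.
have N0 : 0 < N by lra.
have aR : a%:~R + 1 <= a'%:~R :> R by rewrite -(intrD _ a 1) ler_int; lia.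
have mM : m < M by rewrite -(ltr_pM2l (x := N - 1)); lra.
have Af b b' : A (f b b') by rewrite /f; case: b.
have f0 b b' : 0 <= f b b' by have /andP[] := An _ (Af b b').
have f1 b b' : (f b b')%:~R <= N - 1.
  by have /andP[_ h] := An _ (Af b b'); rewrite -(ler_int R) intrB in h.
have fmM b b' : (N - 1) * m <= (f b b')%:~R <= (N - 1) * M.
  by rewrite am aM /f; apply/andP; split; case: b; lra.
have bnd t : m <= coded N f t <= M by exact: coded_bounds.
have codeS u : irrational_unit u -> N * coded N f u =
    (f (bit u) (bit (doubling u)))%:~R + coded N f (doubling u).
  by move=> _; exact: codedS.
have Ninv : 0 < N^-1 by rewrite invr_gt0.
have NN : N * N^-1 = 1 by rewrite mulfV ?gt_eqF.
have low k t : irrational_unit t -> 2 ^- k < t -> m + N^-1 * N ^- k <= coded N f t.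
  apply: (coded_low N2 (ltW Ninv) codeS).
    by move=> u; case/andP: (fmM (bit u) (bit (doubling u))).
  move=> u iu bu; rewrite -(ler_pM2l N0) codeS // mulrDr NN /f bu.
  by have /andP[? _] := bnd (doubling u); lra.
have high k t : irrational_unit t -> 2 ^- k < 1 - t -> coded N f t <= M - N^-1 * N ^- k.
  apply: (coded_high N2 (ltW Ninv) codeS).
    by move=> u; case/andP: (fmM (bit u) (bit (doubling u))).
  move=> u iu /negbTE bu; rewrite -(ler_pM2l N0) codeS // mulrBr NN /f bu.
  by have /andP[_ ?] := bnd (doubling u); lra.
have Nkpos k : 0 < N^-1 * N ^- k by rewrite mulr_gt0 // invr_gt0 exprn_gt0.
have inside t : irrational_unit t -> m < coded N f t < M.
  move=> it; have /andP[t0 t1] := irrational_unitP it; apply/andP; split.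
    have [k kt] := pow2_lt t0; apply: lt_le_trans (low k t it kt).
    by rewrite ltrDl.
  have [k kt] := pow2_lt (etrans (subr_gt0 _ _) t1).
  by apply: le_lt_trans (high k t it kt) _; rewrite ltrBlDr ltrDl.
apply: (dim_uniqueness_set_ge (c := (2 * N)^-1) (f := f)) => //.
- by rewrite invr_gt0; lra.
- move=> t it; have [] := ra _ (inside _ (irrational_doubling it)).
  by rewrite /f; case: (bit t).
- move=> k t t' it it' /negbTE bt bt' _.
  have Nk : N ^- k <= 1.
    by rewrite invf_le1 ?exprn_gt0 //; apply: exprn_ege1; lra.
  have : (2 * N)^-1 * N ^- k <= (2 * N)^-1 by rewrite ler_piMr // invr_ge0; lra.
  move/le_trans; apply; rewrite -(ler_pM2l N0) mulrBr !codeS // /f bt bt'.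
  rewrite (_ : N * _ = 2^-1); last by field; rewrite gt_eqF.
  have /andP[? ?] := bnd (doubling t); have /andP[? ?] := bnd (doubling t').
  (* (N - 1) (M - m) = a' - a, so the tails cost at most half of a' - a *)
  have : 2 * (M - m) <= a'%:~R - a%:~R.
    by rewrite -am -aM -mulrBr ler_wpM2r //; lra.
  lra.
Qed.

Lemma dim_of_left_digit {R : realType} (n : nat) A (a : int) :
  (2 <= n)%N -> A `<=` [set a | 0 <= a <= n%:Z - 1] ->
  A 0 -> A a -> 0 < a -> 2 * a <= n%:Z - 1 -> left_rigid A a ->
  ((ln 2 / ln n%:R)%:E <= hausdorff_dim (uniqueness_set R n A))%E.
Proof.
move=> n2 An A0 Aa a0 an La.
have N2 := natr_ge2 (R := R) n2.
have L0 : left_rigid A 0 by move=> b c /An/andP[? _] /An/andP[? _]; lia.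
have aN : 2 * a%:~R <= n%:R - 1 :> R by rewrite -(ler_int R) intrB intrM in an.
have NN1 : (n%:R - 1 : R) != 0 by rewrite gt_eqF //; lra.
apply: (@dim_of_two_digits R n A 0 a 0 (a%:~R / (n%:R - 1))) => //.
- by lia.
- by rewrite mulr0.
- by rewrite mulrC divfK.
- move=> v /andP[v0 v1]; have vh : v < 2^-1.
    apply: lt_le_trans v1 _; rewrite ler_pdivrMr; lra.
  by split; apply: rigid_of_left => //; rewrite v0.
Qed.

Lemma dim_of_right_digit {R : realType} (n : nat) A (a : int) :
  (2 <= n)%N -> A `<=` [set a | 0 <= a <= n%:Z - 1] ->
  A (n%:Z - 1) -> A a -> a < n%:Z - 1 -> n%:Z - 1 <= 2 * a -> right_rigid A a ->
  ((ln 2 / ln n%:R)%:E <= hausdorff_dim (uniqueness_set R n A))%E.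
Proof.
move=> n2 An An1 Aa an na Ra.
have N2 := natr_ge2 (R := R) n2.
have Rn : right_rigid A (n%:Z - 1) by move=> b c /An/andP[_ ?] /An/andP[_ ?]; lia.
have aN : n%:R - 1 <= 2 * a%:~R :> R by rewrite -(ler_int R) intrB intrM in na.
have NN1 : (n%:R - 1 : R) != 0 by rewrite gt_eqF //; lra.
apply: (@dim_of_two_digits R n A a (n%:Z - 1) (a%:~R / (n%:R - 1)) 1) => //.
- by lia.
- by rewrite mulrC divfK.
- by rewrite mulr1 intrB.
- move=> v /andP[v0 v1]; have vh : 2^-1 < v.
    apply: le_lt_trans v0; rewrite ler_pdivlMr; lra.
  by split; apply: rigid_of_right => //; rewrite v1 andbT.
Qed.

(** The expansions constructed here satisfy: the tail after a digit lies below
1/2 or above 1/2 according to the next binary digit of the parameter.  That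
next binary digit also decides whether the present digit is one of 0, h, which
are left rigid, or one of g, n - 1, which are right rigid. *)
Lemma dim_of_crossing_digits {R : realType} (n : nat) A (g h : int) :
  (2 <= n)%N -> A `<=` [set a | 0 <= a <= n%:Z - 1] ->
  A 0 -> A (n%:Z - 1) -> A g -> A h ->
  2 * g < n%:Z - 1 -> right_rigid A g -> n%:Z - 1 < 2 * h -> left_rigid A h ->
  ((ln 2 / ln n%:R)%:E <= hausdorff_dim (uniqueness_set R n A))%E.
Proof.
move=> n2 An A0 An1 Ag Ah gn Rg nh Lh.
have L0 : left_rigid A 0 by move=> b c /An/andP[? _] /An/andP[? _]; lia.
have Rn : right_rigid A (n%:Z - 1) by move=> b c /An/andP[_ ?] /An/andP[_ ?]; lia.
pose f (b b' : bool) : int :=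
  if b then (if b' then n%:Z - 1 else h) else (if b' then g else 0).
have N2 := natr_ge2 (R := R) n2.
set N : R := n%:R in N2 *.
have N0 : 0 < N by lra.
have Af b b' : A (f b b') by rewrite /f; case: b; case: b'.
have /andP[g0 _] := An _ Ag; have /andP[_ h1] := An _ Ah.
have f0 b b' : 0 <= f b b' by have /andP[] := An _ (Af b b').
have f1 b b' : (f b b')%:~R <= N - 1.
  by have /andP[_ h2] := An _ (Af b b'); rewrite -(ler_int R) intrB in h2.
have fsmall b' : 2 * (f false b')%:~R <= N - 2.
  have : (2 * f false b' <= n%:Z - 2) by rewrite /f; case: b'; lia.
  by rewrite -(ler_int R) intrB intrM.
have fbig b' : N <= 2 * (f true b')%:~R.
  have : (n%:Z <= 2 * f true b') by rewrite /f; case: b'; lia.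
  by rewrite -(ler_int R) intrM.
have f01 b b' : (N - 1) * 0 <= (f b b')%:~R <= (N - 1) * 1.
  by rewrite mulr0 mulr1 ler0z f0 f1.
have bnd t : 0 <= coded N f t <= 1 by exact: coded_bounds.
have codeS u : irrational_unit u -> N * coded N f u =
    (f (bit u) (bit (doubling u)))%:~R + coded N f (doubling u).
  by move=> _; exact: codedS.
have below u : irrational_unit u -> ~~ bit u ->
    coded N f u <= 2^-1 - (1 - coded N f (doubling u)) / N.
  move=> iu /negbTE bu; rewrite -(ler_pM2l N0) codeS // bu mulrBr.
  rewrite [N * (_ / N)]mulrC divfK ?gt_eqF //.
  by have := fsmall (bit (doubling u)); lra.
have above u : irrational_unit u -> bit u ->
    2^-1 + coded N f (doubling u) / N <= coded N f u.
  move=> iu bu; rewrite -(ler_pM2l N0) codeS // bu mulrDr.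
  rewrite [N * (_ / N)]mulrC divfK ?gt_eqF //.
  by have := fbig (bit (doubling u)); lra.
have h0 : 0 <= 2^-1 :> R by rewrite invr_ge0.
have low k t : irrational_unit t -> 2 ^- k < t -> 0 + 2^-1 * N ^- k <= coded N f t.
  apply: (coded_low N2 h0 codeS).
    by move=> u; case/andP: (f01 (bit u) (bit (doubling u))).
  move=> u iu bu; rewrite add0r; apply: le_trans (above u iu bu).
  by have /andP[? _] := bnd (doubling u); rewrite lerDl divr_ge0 // ltW.
have high k t : irrational_unit t -> 2 ^- k < 1 - t -> coded N f t <= 1 - 2^-1 * N ^- k.
  apply: (coded_high N2 h0 codeS).
    by move=> u; case/andP: (f01 (bit u) (bit (doubling u))).
  move=> u iu bu; apply: (le_trans (below u iu bu)).
  have : 0 <= (1 - coded N f (doubling u)) / N.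
    by have /andP[_ ?] := bnd (doubling u); rewrite divr_ge0 ?subr_ge0 // ltW.
  lra.
have Npos k : 0 < 2^-1 * N ^- k by rewrite mulr_gt0 // ?invr_gt0 // exprn_gt0.
have inside t : irrational_unit t -> 0 < coded N f t < 1.
  move=> it; have /andP[t0 t1] := irrational_unitP it; apply/andP; split.
    have [k kt] := pow2_lt t0; apply: lt_le_trans (low k t it kt).
    by rewrite add0r.
  have [k kt] := pow2_lt (etrans (subr_gt0 _ _) t1).
  by apply: le_lt_trans (high k t it kt) _; rewrite ltrBlDr ltrDl.
have Ninv : 0 < N^-1 by rewrite invr_gt0.
apply: (dim_uniqueness_set_ge (c := (2 * N)^-1) (f := f)) => //.
- by rewrite invr_gt0; lra.
- by case; rewrite /f; lia.
- move=> t it; have id := irrational_doubling it; set u := doubling t in id *.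
  have /andP[z0 z1] := inside _ id.
  have /andP[y0 y1] := inside _ (irrational_doubling id).
  have [bu|bu] := boolP (bit u).
    apply: rigid_of_right; first by rewrite /f; case: (bit t).
    rewrite z1 andbT; apply: lt_le_trans (above u id bu).
    by rewrite ltrDl divr_gt0.
  apply: rigid_of_left; first by rewrite /f; case: (bit t).
  rewrite z0 /=; apply: le_lt_trans (below u id bu) _.
  by rewrite ltrBlDr ltrDl divr_gt0 // subr_gt0.
- move=> k t t' it it' bt bt' kT.
  have id := irrational_doubling it; have id' := irrational_doubling it'.
  have Zt := below t it bt; have Zt' := above t' it' bt'.
  suff sum : 2^-1 * N ^- k <= coded N f (doubling t') + (1 - coded N f (doubling t)).
    have : (2^-1 * N ^- k) / N <=
        (coded N f (doubling t') + (1 - coded N f (doubling t))) / N.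
      by rewrite ler_wpM2r // ltW.
    by rewrite invfM [leLHS]mulrAC; lra.
  have /andP[? ?] := bnd (doubling t); have /andP[? ?] := bnd (doubling t').
  have dt : doubling t = 2 * t by rewrite /doubling (negbTE bt) subr0.
  have dt' : doubling t' = 2 * t' - 1 by rewrite /doubling bt'.
  (* 2 (t' - t) = doubling t' + (1 - doubling t) *)
  have [kd|kd] := ltP (2 ^- k) (doubling t').
    by have := low k _ id' kd; lra.
  have kd' : 2 ^- k < 1 - doubling t by lra.
  by have := high k _ id kd'; lra.
Qed.

(** * The remaining digit sets *)

(** [L] and [Q] stand for left and right rigid digits of A; they are abstract
because the statement is also applied to the reflected set. *)
Lemma escape {R : realType} (N : R) (top : int) (L Q : int -> Prop) (W : set R) :
  2 <= N -> N = top%:~R + 1 ->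
  (forall v, W v -> 0 < v < 1) ->
  (forall v, W v -> exists a w, [/\ W w, N * v = a%:~R + w,
     w <= 2^-1 -> L a & 2^-1 <= w -> Q a]) ->
  (forall a, 2 * a <= top -> L a -> a = 0) ->
  (forall a, top <= 2 * a -> Q a -> a = top) ->
  (forall a, 2 * a < top -> ~ Q a) ->
  forall v, ~ W v.
Proof.
move=> N2 Ntop W01 WS Lsmall Qbig Qsmall.
have Wbig v : W v -> 2^-1 <= v.
  move=> Wv; rewrite leNgt; apply/negP => vh.
  have dil k : W (N ^+ k * v) /\ N ^+ k * v < 2^-1.
    elim: k => [|k [Wk kh]]; first by rewrite expr0 mul1r.
    have [a [w [Ww Nw La Qa]]] := WS _ Wk.
    have /andP[w0 w1] := W01 _ Ww.
    have wN : 2 * (a%:~R + w) < N by rewrite -Nw; nra.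
    have [wh|wh] := ltP w 2^-1; last first.
      by have /Qsmall := Qa wh; case; rewrite -(ltr_int R) intrM; lra.
    have atop : (2 * a < top + 1)%R by rewrite -(ltr_int R) intrM intrD; lra.
    have a0 : a = 0 by apply: Lsmall (La (ltW wh)); lia.
    have -> : N ^+ k.+1 * v = w by rewrite exprS -mulrA Nw a0 add0r.
    by split.
  have /andP[v0 _] := W01 _ Wv.
  have : v <= 0 by apply: (geometric_unbounded (M := 2^-1) N2) => k; case: (dil k) => _ /ltW.
  lra.
move=> v Wv.
have dil k : W (1 - N ^+ k * (1 - v)).
  elim: k => [|k Wk]; first by rewrite expr0 mul1r opprB addrC subrK.
  have [a [w [Ww Nw La Qa]]] := WS _ Wk.
  have {}Qa := Qa (Wbig _ Ww).
  have atop : a = top.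
    by apply: Qbig (Qa); rewrite leNgt; apply/negP => /Qsmall.
  rewrite (_ : 1 - _ = w) // exprS -mulrA.
  by move: Nw; rewrite mulrBr mulr1 atop; lra.
have /andP[_ v1] := W01 _ Wv.
have : 1 - v <= 0.
  apply: (geometric_unbounded (M := 1) N2) => k.
  by have /andP[] := W01 _ (dil k); lra.
lra.
Qed.

Theorem theorem3p1 (R : realType) (n : nat) (A : set int)
    (hn : (2 <= n)%N) (hA : n_good R n A) :
  ((ln 2 / ln n%:R)%:E <= hausdorff_dim (uniqueness_set R n A))%E
  \/ uniqueness_set R n A = [set 0; 2].
Proof.
have [A0 An1 An CC] := hA.
set C := cantor_sum_set R n A in CC; set top := n%:Z - 1 in An1 An.
have N2 := natr_ge2 (R := R) hn.
have Ntop : n%:R = top%:~R + 1 :> R by rewrite intrB subrK.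
have CA : digit_attractor (n%:R : R) A C by exact: cantor_attractor.
have [C01 CS _] := CA.
have Csum u : 0 <= u <= 2 -> exists x y, [/\ C x, C y & x + y = u].
  move=> u02; have : minkowski_sum C C u by rewrite CC /= in_itv.
  by case=> x Cx [y Cy xy]; exists x, y.
have [[a [Aa a0 an La]]|noL] := pselect (exists a,
    [/\ A a, 0 < a, 2 * a <= top & left_rigid A a]).
  by left; exact: dim_of_left_digit a0 an La.
have [[a [Aa a0 an Ra]]|noR] := pselect (exists a,
    [/\ A a, a < top, top <= 2 * a & right_rigid A a]).
  by left; exact: dim_of_right_digit a0 an Ra.
have [[[g [Ag gn Rg]] [h [Ah nh Lh]]]|noX] := pselect (
    (exists g, [/\ A g, 2 * g < top & right_rigid A g]) /\
    (exists h, [/\ A h, top < 2 * h & left_rigid A h])).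
  by left; exact: dim_of_crossing_digits gn Rg nh Lh.
right.
pose W : set R := [set v | [/\ unique_half C v, v != 0 & v != 1]].
have W01 v : W v -> 0 < v < 1.
  case=> [[Cv _] v0 v1]; have /andP[? ?] := C01 _ Cv.
  by apply/andP; split; rewrite lt_neqAle ?v1 // eq_sym v0.
have WS v : W v -> exists a w, [/\ W w, n%:R * v = a%:~R + w,
    w <= 2^-1 -> A a /\ left_rigid A a & 2^-1 <= w -> A a /\ right_rigid A a].
  case=> Vv v0 v1; have [a [w [Aa Vw Nv ra]]] := unique_half_step N2 CA Csum Vv.
  have /andP[w0 w1] := C01 _ (proj1 Vw).
  have NN0 : n%:R != 0 :> R by rewrite gt_eqF //; lra.
  exists a, w; split => //.
  - split => //.
    + apply: contra v0 => /eqP w00; rewrite w00 in ra Nv.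
      have a0 := rigid0_eq N2 Ntop CA CC (An _ Aa) ra.
      by move: Nv; rewrite a0 addr0 => /eqP; rewrite mulf_eq0 (negbTE NN0).
    + apply: contra v1 => /eqP w11; rewrite w11 in ra Nv.
      have a0 := rigid1_eq N2 Ntop CA CC (An _ Aa) ra.
      by apply/eqP/(mulfI NN0); rewrite mulr1 Nv a0 Ntop.
  - by move=> wh; split => //; apply: left_of_rigid ra _; rewrite w0.
  - by move=> wh; split => //; apply: right_of_rigid ra _; rewrite w1 andbT.
have Lsmall a : 2 * a <= top -> A a /\ left_rigid A a -> a = 0.
  move=> an [Aa La]; have /andP[a0 _] := An _ Aa.
  by apply/eqP; apply: contrapT => /negP aN; apply: noL; exists a; split => //; lia.
have Rbig a : top <= 2 * a -> A a /\ right_rigid A a -> a = top.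
  move=> an [Aa Ra]; have /andP[_ a1] := An _ Aa.
  by apply/eqP; apply: contrapT => /negP aN; apply: noR; exists a; split => //; lia.
have noW : forall v, ~ W v.
  have [noRs|noLb] : (forall a, 2 * a < top -> ~ (A a /\ right_rigid A a)) \/
      (forall a, top < 2 * a -> ~ (A a /\ left_rigid A a)).
  - have [Rs|noRs] := pselect (exists g, [/\ A g, 2 * g < top & right_rigid A g]).
      right=> a na [Aa La]; apply: noX; split => //; by exists a.
    by left=> a na [Aa Ra]; apply: noRs; exists a.
  - exact: escape N2 Ntop W01 WS Lsmall Rbig noRs.
  - (* reflect by v -> 1 - v and a -> n - 1 - a, which exchanges left and right *)
    move=> v Wv; apply: (@escape R n%:R top
      (fun a => A (top - a) /\ right_rigid A (top - a))
      (fun a => A (top - a) /\ left_rigid A (top - a))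
      [set v | W (1 - v)] N2 Ntop _ _ _ _ _ (1 - v)) => /=.
    + by move=> u /W01/andP[? ?]; apply/andP; split; lra.
    + move=> u /WS[a [w [Ww Nu La Ra]]]; exists (top - a), (1 - w).
      split; rewrite ?subKr //; first by rewrite intrB; lra.
      * by move=> ?; apply: Ra; lra.
      * by move=> ?; apply: La; lra.
    + by move=> a an /Rbig; lia.
    + by move=> a an /Lsmall; lia.
    + by move=> a an; apply: noLb; lia.
    + by rewrite subKr.
have V01 v : unique_half C v -> v = 0 \/ v = 1.
  move=> Vv; have [->|v0] := eqVneq v 0; first by left.
  have [->|v1] := eqVneq v 1; first by right.
  by exfalso; apply: (noW v); split.
have V0 : unique_half C 0.
  have ends x y : C x -> C y -> x + y = 2 * 0 -> x = 0 /\ y = 0.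
    by move=> /C01/andP[? ?] /C01/andP[? ?] ?; split; lra.
  have [x [y [Cx Cy xy]]] : exists x y, [/\ C x, C y & x + y = 2 * 0].
    by apply: Csum; rewrite mulr0 lexx; lra.
  by split => //; have [<- _] := ends _ _ Cx Cy xy.
have V1 : unique_half C 1.
  have ends x y : C x -> C y -> x + y = 2 * 1 -> x = 1 /\ y = 1.
    by move=> /C01/andP[? ?] /C01/andP[? ?] ?; split; lra.
  have [x [y [Cx Cy xy]]] : exists x y, [/\ C x, C y & x + y = 2 * 1].
    by apply: Csum; rewrite mulr1 lexx; lra.
  by split => //; have [<- _] := ends _ _ Cx Cy xy.
apply/seteqP; split => [z|z [->|->]].
- have -> : z = 2 * (z / 2) by lra.
  by move/uniqueness_setP/V01 => [->|->]; [left; rewrite mulr0 | right; rewrite mulr1].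
- by rewrite -(mulr0 2); apply/uniqueness_setP.
- by rewrite -[X in uniqueness_set _ _ _ X](mulr1 2); apply/uniqueness_setP.
Qed.
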